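(* Let $X$ be a Banach space, let $T\in L(X)$, and consider the operator $B_T$ on $c_0(X,\mathbb{Z})$ or on $\ell^p(X,\mathbb{Z})$ with $1\le p<\infty$. The following assertions are equivalent: (1) $B_T$ is mixing; (2) $T$ is mixing on $X$.
   Context: $L(X)$ denotes the bounded linear operators on $X$. $\ell^p(X,\mathbb{Z})$ is the Banach space of families $(x_k)_{k\in\mathbb{Z}}$ in $X$ with $\sum_k\|x_k\|^p<\infty$ (with the $\ell^p$-norm), and $c_0(X,\mathbb{Z})$ is the Banach space of families $(x_k)_{k\in\mathbb{Z}}$ in $X$ with $\lim_{|k|\to\infty}\|x_k\|=0$ (with the sup norm). $B_T$ is the bounded operator $B_T(x_k)_{k\in\mathbb{Z}}=(Tx_{k+1})_{k\in\mathbb{Z}}$. An operator $S$ on a Banach space $Y$ is mixing if for all non-empty open sets $U,V\subset Y$ the set $\{n\ge 0:S^nU\cap V\neq\emptyset\}$ is cofinite. *)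

(* Defs.v *)
From HB Require Import structures.
From mathcomp Require Import all_boot all_order all_algebra.
From mathcomp Require Import complex.
From mathcomp Require Import zify.
From mathcomp Require Import all_classical all_reals all_analysis.

Set Implicit Arguments.
Unset Strict Implicit.
Unset Printing Implicit Defensive.

Import Order.TTheory GRing.Theory Num.Theory.
Import numFieldNormedType.Exports.

Local Open Scope classical_set_scope.
Local Open Scope ring_scope.

Definition mixing (Y : topologicalType) (S : Y -> Y) : Prop :=
  forall U V : set Y, open U -> open V -> U !=set0 -> V !=set0 ->
    cofinite_set [set n : nat | (iter n S @` U) `&` V !=set0].

(* Banach spaces are over R or over C.  In the library the norm of a normed
   module takes its values in the scalar field; over C these values are
   nonnegative reals embedded in C, so to_real is used to read them in R. *)
Variant scalars := RealScalars | ComplexScalars.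

Definition scalar_field (R : realType) (s : scalars) : numFieldType :=
  match s with RealScalars => R | ComplexScalars => R[i]%C end.

Definition to_real (R : realType) (s : scalars) : scalar_field R s -> R :=
  match s with RealScalars => id | ComplexScalars => @complex.Re R end.

Definition of_real (R : realType) (s : scalars) : R -> scalar_field R s :=
  match s with RealScalars => id | ComplexScalars => fun r => r%:C%C end.
Arguments of_real {R} s r.

Definition rnorm (R : realType) (s : scalars)
  (X : normedModType (scalar_field R s)) (x : X) : R := to_real `|x|.

Section scalar_field_theory.
Context {R : realType} {s : scalars}.
Implicit Types (r t : R) (a b : scalar_field R s).

Lemma of_realK r : to_real (of_real s r) = r.
Proof. by case: s. Qed.

Lemma to_realK a : 0 <= a -> of_real s (to_real a) = a.
Proof.
case: s a => //= -[x y]; rewrite lecE /= => /andP[/eqP y0 _].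
by rewrite /real_complex_def -y0.
Qed.

Lemma of_realD r t : of_real s (r + t) = of_real s r + of_real s t.
Proof. by case: s => //=; rewrite rmorphD. Qed.

Lemma of_realM r t : of_real s (r * t) = of_real s r * of_real s t.
Proof. by case: s => //=; rewrite rmorphM. Qed.

Lemma of_real0 : of_real s (0 : R) = 0.
Proof. by case: s. Qed.

Lemma ler_of_real r t : (of_real s r <= of_real s t) = (r <= t).
Proof. by case: s => //=; rewrite lecR. Qed.

Lemma ltr_of_real r t : (of_real s r < of_real s t) = (r < t).
Proof. by case: s => //=; rewrite ltcR. Qed.

Variable X : normedModType (scalar_field R s).
Implicit Types x y : X.

Lemma rnormK x : of_real s (rnorm x) = `|x|.
Proof. by rewrite to_realK. Qed.

Lemma rnorm_ge0 x : 0 <= rnorm x.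
Proof. by rewrite -ler_of_real rnormK of_real0. Qed.

Lemma ler_rnormD x y : rnorm (x + y) <= rnorm x + rnorm y.
Proof. by rewrite -ler_of_real of_realD !rnormK ler_normD. Qed.

Lemma rnormZ a x : rnorm (a *: x) = to_real `|a| * rnorm x.
Proof.
by rewrite -[LHS]of_realK rnormK normrZ -{1}(to_realK (normr_ge0 a)) -rnormK
  -of_realM of_realK.
Qed.

Lemma rnorm0 : rnorm (0 : X) = 0.
Proof. by rewrite /rnorm normr0 -of_real0 of_realK. Qed.

Lemma rnorm_eq0 x : rnorm x = 0 -> x = 0.
Proof. by move=> x0; apply/normr0_eq0; rewrite -rnormK x0 of_real0. Qed.

Lemma rnormN x : rnorm (- x) = rnorm x.
Proof. by rewrite /rnorm normrN. Qed.

Lemma to_real_norm_ge0 a : 0 <= to_real `|a|.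
Proof. by rewrite -ler_of_real to_realK// of_real0. Qed.

Lemma to_real_norm_eq0 a : to_real `|a| = 0 -> a = 0.
Proof.
by move=> a0; apply/normr0_eq0; rewrite -[LHS]to_realK// a0 of_real0.
Qed.

Lemma to_real_normV a : a != 0 -> to_real `|a^-1| * to_real `|a| = 1.
Proof.
move=> a0; rewrite -[LHS]of_realK of_realM !to_realK// -normrM mulVf//.
by rewrite normr1; case: s.
Qed.

End scalar_field_theory.

Lemma bounded_rnorm (R : realType) (s : scalars)
    (X : normedModType (scalar_field R s)) (T : {linear X -> X}) :
  continuous T -> exists2 C : R, 0 < C & forall x, rnorm (T x) <= C * rnorm x.
Proof.
move=> /linear_bounded_continuous/linear_boundedP/pinfty_ex_gt0[C C0 TC].
exists (to_real C).
  by rewrite -(@ltr_of_real R s) to_realK ?of_real0// ltW.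
by move=> x; rewrite -(@ler_of_real R s) of_realM rnormK to_realK ?rnormK// ltW.
Qed.

(* Completeness of both sequence spaces: a Cauchy filter has a coordinatewise
   limit l, and some member of the filter is e-small while still approaching l
   on any finite set of coordinates. *)
Lemma cauchy_coord (R : realType) (s : scalars)
    (X : completeNormedModType (scalar_field R s))
    (E : normedModType (scalar_field R s)) (coord : E -> int -> X)
    (F : set_system E) : ProperFilter F -> cauchy F ->
  (forall y z k, coord (y - z) k = coord y k - coord z k) ->
  (forall y k, rnorm (coord y k) <= rnorm y) ->
  exists l : int -> X, forall e : R, 0 < e -> exists A : set E,
    [/\ F A, forall y z, A y -> A z -> rnorm (y - z) <= e &
        forall (t : seq int) (d : R), 0 < d -> exists2 z, A z &
          forall k, k \in t -> rnorm (coord z k - l k) <= d].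
Proof.
move=> PF /cauchy_ballP cF coordB rnorm_coord.
have small (e : R) : 0 < e -> exists2 A : set E, F A &
    forall y z, A y -> A z -> rnorm (y - z) <= e.
  move=> e0; have se0 : 0 < of_real s e by rewrite -(@of_real0 R s) ltr_of_real.
  have [[A B] /= [FA FB] AB] := cF _ se0; exists (A `&` B).
    exact: filterI.
  move=> y z [Ay _] [_ Bz]; have := AB (y, z) (conj Ay Bz).
  by rewrite /= -ball_normE /= -rnormK ltr_of_real => /ltW.
have cl k : cvg (coord x k @[x --> F]).
  apply: cauchy_cvg; apply/cauchy_ballP => e e0.
  have re0 : 0 < to_real e / 2.
    by rewrite divr_gt0// -(@ltr_of_real R s) of_real0 to_realK// ltW.
  have [A FA AP] := small _ re0.
  exists (coord^~ k @` A, coord^~ k @` A).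
    have FkA : F [set y | (coord^~ k @` A) (coord y k)].
      by apply: filterS FA => y Ay; exists y.
    by split.
  move=> [_ _] [/= [y Ay <-] [z Az <-]]; rewrite -ball_normE /=.
  rewrite -coordB -rnormK -(to_realK (ltW e0)) ltr_of_real.
  rewrite (le_lt_trans (rnorm_coord _ _))// (le_lt_trans (AP _ _ Ay Az))//.
  rewrite ltr_pdivrMr// ltr_pMr ?ltr1n//.
  by rewrite -(@ltr_of_real R s) of_real0 to_realK// ltW.
exists (fun k => lim (coord x k @[x --> F])) => e e0.
have [A FA AP] := small _ e0; exists A; split => // t d d0.
suff /(filterI FA)/filter_ex[z [Az zP]] : F [set z | forall k, k \in t ->
    rnorm (coord z k - lim (coord x k @[x --> F])) <= d] by exists z.
elim: t => [|k t IH]; first by apply: filterE => z k.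
have sd0 : 0 < of_real s d by rewrite -(@of_real0 R s) ltr_of_real.
have /cvgrPdist_le/(_ _ sd0) := cl k => kP.
apply: filterS2 IH kP => z IH kP j.
rewrite inE => /predU1P[->|]; last exact: IH.
by rewrite -rnormN opprB -(@ler_of_real R s) rnormK.
Qed.

Lemma rnorm_cvg (R : realType) (s : scalars)
    (E : normedModType (scalar_field R s)) (F : set_system E) (l : E) :
  Filter F -> (forall e : R, 0 < e -> \forall y \near F, rnorm (l - y) <= e) ->
  F --> l.
Proof.
move=> FF Fl; apply/(@cvgrPdist_le _ _ _ F _ id) => e e0.
have re0 : 0 < to_real e.
  by rewrite -(@ltr_of_real R s) of_real0 to_realK// ltW.
apply: filterS (Fl _ re0) => y ly.
by rewrite -rnormK -[leRHS]to_realK ?ler_of_real// ltW.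
Qed.

Section c0_space.
Context {R : realType} {s : scalars}.
Variable X : normedModType (scalar_field R s).

Definition c0_mem : {pred int -> X} :=
  mem [set x : int -> X | forall e : R, 0 < e ->
    exists N : nat, forall k : int, (N <= absz k)%N -> rnorm (x k) < e].

Record c0 := C0 { c0_val :> int -> X ; _ : c0_val \in c0_mem }.

HB.instance Definition _ := [isSub for c0_val].
HB.instance Definition _ := gen_eqMixin c0.
HB.instance Definition _ := gen_choiceMixin c0.

Lemma c0_memP (x : int -> X) : reflect (forall e : R, 0 < e ->
    exists N : nat, forall k : int, (N <= absz k)%N -> rnorm (x k) < e)
  (x \in c0_mem).
Proof. by apply: (iffP idP); rewrite inE. Qed.

Lemma c0_submod_closed : submod_closed c0_mem.
Proof.
split.
  by apply/c0_memP => e e0; exists 0%N => k _; rewrite rnorm0.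
move=> a x y /c0_memP xc /c0_memP yc; apply/c0_memP => e e0.
have a1 : 0 < to_real `|a| + 1 by rewrite ltr_wpDl// to_real_norm_ge0.
have [|N1 N1P] := xc (e / 2 / (to_real `|a| + 1)); first by rewrite !divr_gt0.
have [|N2 N2P] := yc (e / 2); first by rewrite divr_gt0.
exists (maxn N1 N2) => k; rewrite geq_max => /andP[/N1P xk /N2P yk].
rewrite (le_lt_trans (ler_rnormD _ _))// [ltRHS]splitr ler_ltD//.
rewrite rnormZ (le_trans (ler_wpM2l (to_real_norm_ge0 a) (ltW xk)))//.
rewrite mulrCA ler_piMr ?divr_ge0// ?(ltW e0)//.
by rewrite ler_pdivrMr// mul1r lerDl.
Qed.

HB.instance Definition _ :=
  GRing.isSubmodClosed.Build _ _ c0_mem c0_submod_closed.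
HB.instance Definition _ := [SubChoice_isSubLmodule of c0 by <:].

Definition c0_norm (x : c0) : R := sup [set rnorm (x k) | k in [set: int]].

Lemma c0P (x : c0) (e : R) : 0 < e ->
  exists N : nat, forall k : int, (N <= absz k)%N -> rnorm (x k) < e.
Proof. by move=> e0; have /c0_memP := valP x; apply. Qed.

Lemma c0_has_sup (x : c0) : has_sup [set rnorm (x k) | k in [set: int]].
Proof.
split; first by exists (rnorm (x 0)), 0.
have [N NP] := c0P x (@ltr01 R).
exists (\sum_(i < N) (rnorm (x (Posz i)) + rnorm (x (- Posz i))) + 1).
move=> _ [k _ <-]; have [Nk|kN] := leqP N (absz k).
  rewrite (le_trans (ltW (NP _ Nk)))// lerDr sumr_ge0// => i _.
  by rewrite addr_ge0 ?rnorm_ge0.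
have xk : rnorm (x k) <= rnorm (x (absz k)) + rnorm (x (- Posz (absz k))).
  by case: k {kN} => n; rewrite ?NegzE /= ?abszN ?lerDl ?lerDr rnorm_ge0.
rewrite (le_trans xk)// ler_wpDr// (bigD1 (Ordinal kN))//= lerDl.
by apply: sumr_ge0 => i _; rewrite addr_ge0 ?rnorm_ge0.
Qed.

Lemma c0_norm_le (x : c0) (M : R) :
  c0_norm x <= M <-> forall k, rnorm (x k) <= M.
Proof.
split=> [xM k|xM].
  rewrite (le_trans _ xM)//; apply: sup_upper_bound; first exact: c0_has_sup.
  by exists k.
apply: ge_sup; first by case: (c0_has_sup x).
by move=> _ [k _ <-].
Qed.

Lemma rnorm_le_c0_norm (x : c0) k : rnorm (x k) <= c0_norm x.
Proof. by move: k; apply/c0_norm_le. Qed.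

Lemma c0_norm_ge0 (x : c0) : 0 <= c0_norm x.
Proof. by rewrite (le_trans _ (rnorm_le_c0_norm x 0))// rnorm_ge0. Qed.

Lemma c0_normD (x y : c0) : c0_norm (x + y) <= c0_norm x + c0_norm y.
Proof.
apply/c0_norm_le => k; rewrite (le_trans (ler_rnormD _ _))//.
by rewrite lerD// rnorm_le_c0_norm.
Qed.

Lemma c0_normZ_le a (x : c0) : c0_norm (a *: x) <= to_real `|a| * c0_norm x.
Proof.
apply/c0_norm_le => k; rewrite rnormZ ler_wpM2l ?to_real_norm_ge0//.
exact: rnorm_le_c0_norm.
Qed.

Lemma c0_normZ a (x : c0) : c0_norm (a *: x) = to_real `|a| * c0_norm x.
Proof.
apply/eqP; rewrite eq_le c0_normZ_le/=; have [->|a0] := eqVneq a 0.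
  by rewrite normr0 -(@of_real0 R s) of_realK mul0r c0_norm_ge0.
rewrite -[X in _ * c0_norm X](scalerK a0).
rewrite (le_trans (ler_wpM2l (to_real_norm_ge0 a) (c0_normZ_le _ _)))//.
by rewrite mulrA (mulrC (to_real `|a|)) to_real_normV// mul1r.
Qed.

Lemma c0_norm_eq0 (x : c0) : c0_norm x = 0 -> x = 0.
Proof.
move=> x0; apply/val_inj/funext => k /=; apply/rnorm_eq0/eqP.
by rewrite eq_le rnorm_ge0 andbT -x0 rnorm_le_c0_norm.
Qed.

Let norm (x : c0) : scalar_field R s := of_real s (c0_norm x).

Let norm_triangle x y : norm (x + y) <= norm x + norm y.
Proof. by rewrite /norm -of_realD ler_of_real c0_normD. Qed.

Let normZ a x : norm (a *: x) = `|a| * norm x.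
Proof. by rewrite /norm c0_normZ of_realM to_realK. Qed.

Let norm_eq0 x : norm x = 0 -> x = 0.
Proof.
move=> x0; apply/c0_norm_eq0.
by rewrite -[LHS](@of_realK R s) -/(norm x) x0 -(@of_real0 R s) of_realK.
Qed.

HB.instance Definition _ := Lmodule_isNormed.Build (scalar_field R s) c0
  norm_triangle normZ norm_eq0.

Lemma rnorm_c0 (x : c0) : rnorm x = c0_norm x.
Proof. exact: of_realK. Qed.

End c0_space.

Section c0_complete.
Context {R : realType} {s : scalars}.
Variable X : completeNormedModType (scalar_field R s).

Let c0_cauchy_cvg (F : set_system (c0 X)) :
  ProperFilter F -> cauchy F -> cvg F.
Proof.
move=> PF cF.
have [||l lP] := @cauchy_coord R s X (c0 X) (@c0_val R s X) F PF cF.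
- by [].
- by move=> y k; rewrite rnorm_c0 rnorm_le_c0_norm.
have near_l (e : R) : 0 < e -> exists2 A : set (c0 X), F A &
    forall y, A y -> forall k, rnorm (y k - l k) <= e.
  move=> e0; have e20 : 0 < e / 2 by rewrite divr_gt0.
  have [A [FA AP lA]] := lP _ e20; exists A => // y Ay k.
  have [z Az zl] := lA [:: k] _ e20.
  rewrite -[y k](subrK (z k)) -addrA (le_trans (ler_rnormD _ _))//.
  rewrite [leRHS]splitr lerD// ?zl ?mem_head// (le_trans _ (AP _ _ Ay Az))//.
  by rewrite rnorm_c0 (rnorm_le_c0_norm (y - z)).
have lc : l \in @c0_mem R s X.
  apply/c0_memP => e e0; have e20 : 0 < e / 2 by rewrite divr_gt0.
  have [A FA AP] := near_l _ e20; have [y Ay] := filter_ex FA.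
  have [N NP] := c0P y e20; exists N => k /NP yk.
  rewrite -(subKr (y k) (l k)) (le_lt_trans (ler_rnormD _ _))// rnormN.
  by rewrite [ltRHS]splitr ltr_leD// AP.
apply/cvg_ex; exists (C0 lc); apply: rnorm_cvg => e e0.
have [A FA AP] := near_l _ e0; apply: filterS FA => y Ay.
rewrite -rnormN opprB rnorm_c0; apply/c0_norm_le => k; exact: AP.
Qed.

HB.instance Definition _ := Uniform_isComplete.Build (c0 X) c0_cauchy_cvg.

End c0_complete.

Lemma minkowski_seq (R : realType) (p : R) (t : seq int) (f g : int -> R)
    (a b : R) : 1 <= p -> (forall k, 0 <= f k) -> (forall k, 0 <= g k) ->
  0 < a -> 0 < b ->
  \sum_(k <- t) f k `^ p <= a `^ p -> \sum_(k <- t) g k `^ p <= b `^ p ->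
  \sum_(k <- t) (f k + g k) `^ p <= (a + b) `^ p.
Proof.
move=> p1 f0 g0 a0 b0 fa gb; have ab0 : 0 < a + b by rewrite addr_gt0.
have div_powR x c : 0 <= x -> 0 < c -> (x / c) `^ p = x `^ p / c `^ p.
  move=> x0 c0; rewrite powRM ?invr_ge0 ?(ltW c0)//.
  by rewrite -[c^-1](powR_inv1 (ltW c0)) -powRrM mulN1r powRN.
pose u := a / (a + b).
have u0 : 0 <= u by rewrite divr_ge0// ltW.
have u1 : u <= 1 by rewrite ler_pdivrMr// mul1r lerDl ltW.
have uE : 1 - u = b / (a + b).
  by rewrite /u -{1}(divff (lt0r_neq0 ab0)) -mulrBl addrAC subrr add0r.
have conv k : ((f k + g k) / (a + b)) `^ p <=
    u * (f k `^ p / a `^ p) + (1 - u) * (g k `^ p / b `^ p).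
  have -> : (f k + g k) / (a + b) = u * (f k / a) + (1 - u) * (g k / b).
    rewrite uE /u mulrDl; congr (_ + _).
      by rewrite (mulrC a) -mulrA (mulrCA a) divff ?gt_eqF// mulr1 mulrC.
    by rewrite (mulrC b) -mulrA (mulrCA b) divff ?gt_eqF// mulr1 mulrC.
  rewrite -!div_powR//.
  have := @convex_powR R p p1 (Itv01 u0 u1) (f k / a) (g k / b).
  rewrite !inE /= !in_itv /= !andbT !divr_ge0 ?(ltW a0) ?(ltW b0)//.
  by rewrite !convRE /= => /(_ isT isT).
have : \sum_(k <- t) ((f k + g k) / (a + b)) `^ p <= 1.
  apply: (le_trans (ler_sum _ (fun k _ => conv k))).
  rewrite big_split/= -!mulr_sumr -!mulr_suml.
  rewrite -[leRHS](subrKC u) lerD// ler_piMr// ?subr_ge0//.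
    by rewrite ler_pdivrMr ?mul1r// powR_gt0.
  by rewrite ler_pdivrMr ?mul1r// powR_gt0.
have abp : 0 < (a + b) `^ p by rewrite powR_gt0.
move=> /(ler_wpM2r (ltW abp)); rewrite mul1r mulr_suml; apply: le_trans.
apply: ler_sum => k _; rewrite div_powR ?addr_ge0//.
by rewrite divfK// gt_eqF.
Qed.

Lemma esum_leP (R : realType) (f : int -> R) (M : R) :
  ((\esum_(k in [set: int]) (f k)%:E <= M%:E)%E) <->
  forall t : seq int, uniq t -> \sum_(k <- t) f k <= M.
Proof.
split=> [fM t ut|fM].
  rewrite -lee_fin (le_trans _ fM)// esum_ge//.
  exists [set` t]; first by split=> //; exact: finite_seq.
  by rewrite -fsbig_seq// sumEFin.
apply: ge_ereal_sup => x [A [finA _]] <-.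
by rewrite fsbig_finite//= sumEFin lee_fin; apply: fM; exact: finmap.fset_uniq.
Qed.

Section lp_space.
Context {R : realType} {s : scalars}.
Variable X : normedModType (scalar_field R s).

(* Unordered sum over Z of the nonnegative terms, in [0, +oo]. *)
Definition lp_sum (p : R) (x : int -> X) : \bar R :=
  (\esum_(k in [set: int]) (rnorm (x k) `^ p)%:E)%E.

Definition lp_mem (p : R) : {pred int -> X} :=
  mem [set x : int -> X | (lp_sum p x < +oo)%E].

Record lp (p : R) (p1 : 1 <= p) :=
  Lp { lp_val :> int -> X ; _ : lp_val \in lp_mem p }.

Variables (p : R) (p1 : 1 <= p).
Notation lpX := (lp p1).

HB.instance Definition _ := [isSub for @lp_val p p1].
HB.instance Definition _ := gen_eqMixin lpX.
HB.instance Definition _ := gen_choiceMixin lpX.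

Let p_gt0 : 0 < p. Proof. exact: lt_le_trans p1. Qed.

Lemma lp_sum_ge0 (x : int -> X) : (0 <= lp_sum p x)%E.
Proof. by apply: esum_ge0 => k _; rewrite lee_fin powR_ge0. Qed.

Lemma lp_memP (x : int -> X) : x \in lp_mem p <->
  exists2 M : R, 0 < M & forall t : seq int, uniq t ->
    \sum_(k <- t) rnorm (x k) `^ p <= M `^ p.
Proof.
rewrite inE /=; split=> [xoo|[M M0 xM]]; last first.
  by rewrite (@le_lt_trans _ _ (M `^ p)%:E) ?ltry//; apply/esum_leP.
have fin : lp_sum p x \is a fin_num by rewrite ge0_fin_numE// lp_sum_ge0.
have S0 : 0 <= fine (lp_sum p x) by rewrite fine_ge0// lp_sum_ge0.
exists ((fine (lp_sum p x) + 1) `^ p^-1).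
  by apply: powR_gt0; rewrite ltr_wpDl.
rewrite -powRrM mulVf ?gt_eqF// powRr1 ?addr_ge0//; apply/esum_leP.
by rewrite -/(lp_sum p x) -[leLHS]fineK// lee_fin lerDl.
Qed.

Lemma lp_submod_closed : submod_closed (lp_mem p).
Proof.
split.
  apply/lp_memP; exists 1 => // t _; rewrite big1 ?powR_ge0// => k _.
  by rewrite rnorm0 powR0// gt_eqF.
move=> a x y /lp_memP[M M0 xM] /lp_memP[N N0 yN]; apply/lp_memP.
have a1 : 0 < to_real `|a| + 1 by rewrite ltr_wpDl// to_real_norm_ge0.
exists ((to_real `|a| + 1) * M + N) => [|t ut].
  by rewrite addr_gt0// mulr_gt0.
have ax0 k : 0 <= (to_real `|a| + 1) * rnorm (x k).
  by rewrite mulr_ge0 ?rnorm_ge0// ltW.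
have := @minkowski_seq R p t (fun k => (to_real `|a| + 1) * rnorm (x k))
  (fun k => rnorm (y k)) ((to_real `|a| + 1) * M) N p1 ax0
  (fun k => rnorm_ge0 _) (mulr_gt0 a1 M0) N0.
have -> : \sum_(k <- t) ((to_real `|a| + 1) * rnorm (x k)) `^ p =
    (to_real `|a| + 1) `^ p * \sum_(k <- t) rnorm (x k) `^ p.
  rewrite mulr_sumr; apply: eq_bigr => k _.
  by rewrite powRM// ?rnorm_ge0// ltW.
rewrite (powRM _ (ltW a1) (ltW M0)) ler_wpM2l ?powR_ge0 ?xM//.
move=> /(_ isT (yN _ ut)).
apply: le_trans; apply: ler_sum => k _; apply: ge0_ler_powR.
- exact: ltW.
- by rewrite nnegrE rnorm_ge0.
- by rewrite nnegrE addr_ge0 ?rnorm_ge0.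
rewrite (le_trans (ler_rnormD _ _))// lerD2r rnormZ.
by rewrite ler_wpM2r ?rnorm_ge0// lerDl.
Qed.

HB.instance Definition _ :=
  GRing.isSubmodClosed.Build _ _ (lp_mem p) lp_submod_closed.
HB.instance Definition _ := [SubChoice_isSubLmodule of lpX by <:].

Definition lp_norm (x : lpX) : R := fine (lp_sum p x) `^ p^-1.

Lemma lp_sum_fin (x : lpX) : lp_sum p x \is a fin_num.
Proof.
rewrite ge0_fin_numE ?lp_sum_ge0//.
by have := valP x; rewrite inE.
Qed.

Lemma lp_norm_ge0 (x : lpX) : 0 <= lp_norm x.
Proof. exact: powR_ge0. Qed.

Lemma lp_norm_le (x : lpX) (M : R) : 0 <= M -> lp_norm x <= M <->
  forall t : seq int, uniq t -> \sum_(k <- t) rnorm (x k) `^ p <= M `^ p.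
Proof.
move=> M0; have S0 : 0 <= fine (lp_sum p x) by rewrite fine_ge0// lp_sum_ge0.
have p0 := p_gt0; apply: iff_trans (esum_leP _ _).
rewrite -/(lp_sum p x) -[X in (X <= _)%E](fineK (lp_sum_fin x)) lee_fin.
split=> [xM|xM].
  have := @ge0_ler_powR R p (ltW p0) _ _ (lp_norm_ge0 x) M0 xM.
  by rewrite /lp_norm -powRrM mulVf ?gt_eqF// powRr1.
have pV0 : 0 <= p^-1 by rewrite invr_ge0 ltW.
have := @ge0_ler_powR R p^-1 pV0 _ _ S0 (powR_ge0 M p) xM.
by rewrite -powRrM mulfV ?gt_eqF// powRr1.
Qed.

Lemma rnorm_le_lp_norm (x : lpX) k : rnorm (x k) <= lp_norm x.
Proof.
have /(lp_norm_le x (lp_norm_ge0 x))/(_ [:: k] isT) := lexx (lp_norm x).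
rewrite big_seq1 leNgt => xk; rewrite leNgt; apply: contra xk => xk.
by rewrite gt0_ltr_powR ?nnegrE ?lp_norm_ge0 ?rnorm_ge0.
Qed.

Lemma lp_normD (x y : lpX) : lp_norm (x + y) <= lp_norm x + lp_norm y.
Proof.
apply/ler_addgt0Pl => e e0; have e20 : 0 < e / 2 by rewrite divr_gt0.
rewrite [leRHS]addrC [X in _ <= _ + X]splitr addrACA.
have xe : 0 < lp_norm x + e / 2 by rewrite ltr_wpDl ?lp_norm_ge0.
have ye : 0 < lp_norm y + e / 2 by rewrite ltr_wpDl ?lp_norm_ge0.
apply: (iffRL (lp_norm_le _ (addr_ge0 (ltW xe) (ltW ye)))) => t ut.
apply: (le_trans _ (@minkowski_seq R p t (fun k => rnorm (x k))
  (fun k => rnorm (y k)) _ _ p1 _ _ xe ye _ _)).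
- apply: ler_sum => k _; apply: ge0_ler_powR (ltW p_gt0) _ _ _ _ _.
  + by rewrite nnegrE rnorm_ge0.
  + by rewrite nnegrE addr_ge0 ?rnorm_ge0.
  + exact: ler_rnormD.
- by move=> k; exact: rnorm_ge0.
- by move=> k; exact: rnorm_ge0.
- by move: t ut; apply: (iffLR (lp_norm_le _ (ltW xe))); rewrite lerDl ltW.
- by move: t ut; apply: (iffLR (lp_norm_le _ (ltW ye))); rewrite lerDl ltW.
Qed.

Lemma lp_normZ_le a (x : lpX) : lp_norm (a *: x) <= to_real `|a| * lp_norm x.
Proof.
have a0 := to_real_norm_ge0 a.
apply: (iffRL (lp_norm_le _ (mulr_ge0 a0 (lp_norm_ge0 x)))) => t ut.
rewrite (eq_bigr (fun k => to_real `|a| `^ p * rnorm (x k) `^ p)); last first.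
  by move=> k _; rewrite -powRM ?rnorm_ge0// -rnormZ.
rewrite -mulr_sumr powRM ?lp_norm_ge0// ler_wpM2l ?powR_ge0//.
by move: t ut; apply: (iffLR (lp_norm_le _ (lp_norm_ge0 x))).
Qed.

Lemma lp_normZ a (x : lpX) : lp_norm (a *: x) = to_real `|a| * lp_norm x.
Proof.
apply/eqP; rewrite eq_le lp_normZ_le/=; have [->|a0] := eqVneq a 0.
  by rewrite normr0 -(@of_real0 R s) of_realK mul0r lp_norm_ge0.
rewrite -[X in _ * lp_norm X](scalerK a0).
rewrite (le_trans (ler_wpM2l (to_real_norm_ge0 a) (lp_normZ_le _ _)))//.
by rewrite mulrA (mulrC (to_real `|a|)) to_real_normV// mul1r.
Qed.

Lemma lp_norm_eq0 (x : lpX) : lp_norm x = 0 -> x = 0.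
Proof.
move=> x0; apply/val_inj/funext => k /=; apply/rnorm_eq0/eqP.
by rewrite eq_le rnorm_ge0 andbT -x0 rnorm_le_lp_norm.
Qed.

Let norm (x : lpX) : scalar_field R s := of_real s (lp_norm x).

Let norm_triangle x y : norm (x + y) <= norm x + norm y.
Proof. by rewrite /norm -of_realD ler_of_real lp_normD. Qed.

Let normZ a x : norm (a *: x) = `|a| * norm x.
Proof. by rewrite /norm lp_normZ of_realM to_realK. Qed.

Let norm_eq0 x : norm x = 0 -> x = 0.
Proof.
move=> x0; apply/lp_norm_eq0.
by rewrite -[LHS](@of_realK R s) -/(norm x) x0 -(@of_real0 R s) of_realK.
Qed.

HB.instance Definition _ := Lmodule_isNormed.Build (scalar_field R s) lpX
  norm_triangle normZ norm_eq0.

Lemma rnorm_lp (x : lpX) : rnorm x = lp_norm x.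
Proof. exact: of_realK. Qed.

End lp_space.

Section lp_complete.
Context {R : realType} {s : scalars}.
Variables (X : completeNormedModType (scalar_field R s)) (p : R) (p1 : 1 <= p).
Notation lpX := (lp X p1).

Let lp_cauchy_cvg (F : set_system lpX) : ProperFilter F -> cauchy F -> cvg F.
Proof.
move=> PF cF; have p0 : 0 < p by exact: lt_le_trans p1.
have [||l lP] := @cauchy_coord R s X lpX (@lp_val R s X p p1) F PF cF.
- by [].
- by move=> y k; rewrite rnorm_lp rnorm_le_lp_norm.
have near_l (e : R) : 0 < e -> exists2 A : set lpX, F A &
    forall y, A y -> forall t : seq int, uniq t ->
      \sum_(k <- t) rnorm (y k - l k) `^ p <= e `^ p.
  move=> e0; have e20 : 0 < e / 2 by rewrite divr_gt0.
  have [A [FA AP lA]] := lP _ e20; exists A => // y Ay t ut.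
  pose n : R := (size t)%:R + 1; have n0 : 0 < n by rewrite ltr_wpDl.
  have d0 : 0 < e / 2 * n `^ (- p^-1) by rewrite mulr_gt0// powR_gt0.
  have [z Az zl] := lA t _ d0.
  rewrite [X in X `^ _]splitr; apply: (le_trans _ (@minkowski_seq R p t
    (fun k => rnorm (y k - z k)) (fun k => rnorm (z k - l k)) _ _ p1 _ _
    e20 e20 _ _)).
  - apply: ler_sum => k _; apply: ge0_ler_powR (ltW p0) _ _ _ _ _.
    + by rewrite nnegrE rnorm_ge0.
    + by rewrite nnegrE addr_ge0 ?rnorm_ge0.
    + by rewrite -[X in rnorm (X - l k)](subrK (z k)) -addrA ler_rnormD.
  - by move=> k; exact: rnorm_ge0.
  - by move=> k; exact: rnorm_ge0.
  - have := AP _ _ Ay Az; rewrite rnorm_lp.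
    by move=> /(lp_norm_le _ (ltW e20))/(_ _ ut).
  apply: (@le_trans _ _ (\sum_(k <- t) (e / 2 * n `^ (- p^-1)) `^ p)).
    rewrite !big_seq; apply: ler_sum => k kt.
    apply: ge0_ler_powR (ltW p0) _ _ _ _ _.
    + by rewrite nnegrE rnorm_ge0.
    + by rewrite nnegrE ltW.
    + exact: zl.
  rewrite powRM ?powR_ge0 ?(ltW e20)// -powRrM mulNr mulVf ?gt_eqF//.
  rewrite powR_inv1 ?(ltW n0)// big_const_seq count_predT iter_addr_0.
  rewrite -[leLHS]mulr_natr -mulrA ler_piMr ?powR_ge0// mulrC.
  by rewrite ler_pdivrMr// mul1r lerDl.
have lc : l \in @lp_mem R s X p.
  have [A FA AP] := near_l 1 ltr01; have [y Ay] := filter_ex FA.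
  have yl : y \- l \in @lp_mem R s X p.
    by apply/(lp_memP p1); exists 1 => // t ut; exact: AP.
  have [_ lin] := @lp_submod_closed R s X p p1.
  suff -> : l = -1 *: (y \- l) + val y by exact: lin (valP y).
  by apply/funext => k; rewrite !fctE /= scaleN1r opprB subrK.
apply/cvg_ex; exists (Lp p1 lc); apply: rnorm_cvg => e e0.
have [A FA AP] := near_l _ e0; apply: filterS FA => y Ay.
rewrite -rnormN opprB rnorm_lp; apply: (iffRL (lp_norm_le _ (ltW e0))).
exact: AP.
Qed.

HB.instance Definition _ := Uniform_isComplete.Build lpX lp_cauchy_cvg.

End lp_complete.

Lemma rnorm_continuous (R : realType) (s : scalars)
    (X Y : normedModType (scalar_field R s)) (f : {linear X -> Y}) (C : R) :
  0 < C -> (forall x, rnorm (f x) <= C * rnorm x) -> continuous f.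
Proof.
move=> C0 fC; apply/linear_bounded_continuous/linear_boundedP; near=> r => x.
have Cr : of_real s C <= r.
  near: r; apply: nbhs_pinfty_ge.
  by rewrite ger0_real// -(@of_real0 R s) ler_of_real ltW.
rewrite (@le_trans _ _ (of_real s C * `|x|))//; last by rewrite ler_wpM2r.
by rewrite -!rnormK -of_realM ler_of_real.
Unshelve. all: by end_near. Qed.

Section shift_operators.
Context {R : realType} {s : scalars}.
Variables (X : normedModType (scalar_field R s)) (T : {linear X -> X}).
Hypothesis T_cont : continuous T.

Definition shift_seq (x : int -> X) : int -> X := fun k => T (x (k + 1)).

Lemma shift_seq_c0 (x : int -> X) :
  x \in @c0_mem R s X -> shift_seq x \in @c0_mem R s X.
Proof.
have [C C0 TC] := bounded_rnorm T_cont.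
move=> /c0_memP xc; apply/c0_memP => e e0.
have [|N NP] := xc (e / C); first by rewrite divr_gt0.
exists N.+1 => k Nk; rewrite (le_lt_trans (TC _))// mulrC -ltr_pdivlMr//.
by apply: NP; lia.
Qed.

Definition B_c0 (x : c0 X) : c0 X := C0 (shift_seq_c0 (valP x)).

Lemma B_c0_is_linear : linear B_c0.
Proof.
by move=> a x y; apply/val_inj/funext => k; rewrite /= /shift_seq linearP.
Qed.

HB.instance Definition _ :=
  GRing.isLinear.Build (scalar_field R s) (c0 X) (c0 X) *:%R B_c0
    B_c0_is_linear.

Lemma B_c0_continuous : continuous B_c0.
Proof.
have [C C0 TC] := bounded_rnorm T_cont.
apply: (@rnorm_continuous _ _ _ _ B_c0 C C0) => x.
rewrite !rnorm_c0; apply/c0_norm_le => k; rewrite (le_trans (TC _))//.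
by rewrite ler_wpM2l ?rnorm_le_c0_norm// ltW.
Qed.

Variables (p : R) (p1 : 1 <= p).

Lemma shift_seq_sum (C M : R) (x : int -> X) : 0 < C -> 0 <= M ->
    (forall y, rnorm (T y) <= C * rnorm y) ->
    (forall t : seq int, uniq t ->
      \sum_(k <- t) rnorm (x k) `^ p <= M `^ p) ->
  forall t : seq int, uniq t ->
    \sum_(k <- t) rnorm (shift_seq x k) `^ p <= (C * M) `^ p.
Proof.
move=> C0 M0 TC xM t ut; rewrite powRM ?(ltW C0)//.
have ut1 : uniq [seq k + 1 | k <- t] by rewrite map_inj_uniq//; exact: addIr.
apply: le_trans (ler_wpM2l (powR_ge0 _ _) (xM _ ut1)).
rewrite big_map mulr_sumr; apply: ler_sum => k _.
rewrite -powRM ?rnorm_ge0 ?(ltW C0)//; apply: ge0_ler_powR.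
- by rewrite (le_trans _ p1).
- by rewrite nnegrE rnorm_ge0.
- by rewrite nnegrE mulr_ge0 ?rnorm_ge0// ltW.
- exact: TC.
Qed.

Lemma shift_seq_lp (x : int -> X) :
  x \in @lp_mem R s X p -> shift_seq x \in @lp_mem R s X p.
Proof.
have [C C0 TC] := bounded_rnorm T_cont.
move=> /(lp_memP p1)[M M0 xM]; apply/(lp_memP p1); exists (C * M).
  exact: mulr_gt0.
exact: shift_seq_sum (ltW M0) TC xM.
Qed.

Definition B_lp (x : lp X p1) : lp X p1 := Lp p1 (shift_seq_lp (valP x)).

Lemma B_lp_is_linear : linear B_lp.
Proof.
by move=> a x y; apply/val_inj/funext => k; rewrite /= /shift_seq linearP.
Qed.

HB.instance Definition _ :=
  GRing.isLinear.Build (scalar_field R s) (lp X p1) (lp X p1) *:%R B_lp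
    B_lp_is_linear.

Lemma B_lp_continuous : continuous B_lp.
Proof.
have [C C0 TC] := bounded_rnorm T_cont.
apply: (@rnorm_continuous _ _ _ _ B_lp C C0) => x.
have x0 := lp_norm_ge0 x.
rewrite !rnorm_lp; apply: (iffRL (lp_norm_le _ (mulr_ge0 (ltW C0) x0))).
apply: (shift_seq_sum C0 x0 TC).
exact: (iffLR (lp_norm_le _ x0)).
Qed.

End shift_operators.

Arguments B_c0 {R s X T} T_cont x.
Arguments B_lp {R s X T} T_cont {p} p1 x.

(* Main.v *)
(* Call (x, y) a mixing pair of S if for all neighbourhoods U of x and V of y,
   S^n U meets V for all but finitely many n. For a linear S mixing pairs form
   a closed set stable under addition, so S is mixing as soon as (x, 0) and
   (0, y) are mixing pairs for x and y in sets with dense additive span.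
   Through 0, B_T and T see the same pairs: (B_T^n z)_k = T^n z_(k+n), hence
   restriction to one coordinate sends mixing pairs (x, 0) and (0, y) of B_T to
   mixing pairs of T. Conversely, write d_k a for the sequence with the single
   entry a, at place k. If z is close to a and T^n z to 0, then d_k z is close
   to d_k a and B_T^n (d_k z) to 0; if z is close to 0 and T^n z to a, then
   d_(k+n) z is close to 0 and B_T^n (d_(k+n) z) to d_k a. *)
Require Import Defs.
From HB Require Import structures.
From mathcomp Require Import all_boot all_order all_algebra.
From mathcomp Require Import all_classical all_reals all_analysis.

Set Implicit Arguments.
Unset Strict Implicit.
Unset Printing Implicit Defensive.

Import Order.TTheory GRing.Theory Num.Theory.
Import numFieldNormedType.Exports.

Local Open Scope classical_set_scope.
Local Open Scope ring_scope.

(** * Mixing pairs: characterization of mixing, sums and limits *)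

Section mixing_pairs.
Context {R : realType} {s : scalars} {Y : normedModType (scalar_field R s)}.

Definition mixing_pair (S : Y -> Y) (x y : Y) : Prop :=
  forall e : R, 0 < e -> cofinite_set
    [set n : nat | exists z, rnorm (z - x) < e /\ rnorm (iter n S z - y) < e].

Lemma ball_rnorm (x z : Y) (e : R) :
  ball x (of_real s e) z = (rnorm (z - x) < e) :> Prop.
Proof. by rewrite -ball_normE /= distrC -rnormK ltr_of_real. Qed.

Lemma open_rnorm (U : set Y) (x : Y) : open U -> U x ->
  exists2 e : R, 0 < e & forall z, rnorm (z - x) < e -> U z.
Proof.
move=> oU Ux; have /nbhs_ballP[e /= e0 eU] := open_nbhs_nbhs (conj oU Ux).
exists (to_real e).
  by rewrite -(@ltr_of_real R s) of_real0 to_realK// ltW.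
by move=> z xz; apply: eU; rewrite -[e]to_realK ?ltW// ball_rnorm.
Qed.

Lemma mixingP (S : Y -> Y) : mixing S <-> forall x y, mixing_pair S x y.
Proof.
split=> [mS x y e e0|mS U V oU oV [x Ux] [y Vy]].
  have se0 : 0 < of_real s e by rewrite -(@of_real0 R s) ltr_of_real.
  have := mS _ _ (ball_open x (of_real s e)) (ball_open y (of_real s e))
    (ex_intro _ x (ballxx _ se0)) (ex_intro _ y (ballxx _ se0)).
  apply: sub_cofinite_set => n [_ [[z xz <-] yz]].
  by exists z; move: xz yz; rewrite !ball_rnorm.
have [a a0 aU] := open_rnorm oU Ux; have [b b0 bV] := open_rnorm oV Vy.
have ab0 : 0 < Num.min a b by rewrite lt_min a0.
apply: sub_cofinite_set (mS x y _ ab0) => n [z []].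
rewrite !lt_min => /andP[xz _] /andP[_ yz].
by exists (iter n S z); split; [exists z => //; exact: aU|exact: bV].
Qed.

Variable S : {linear Y -> Y}.

Lemma iter_linearD n (x y : Y) :
  iter n S (x + y) = iter n S x + iter n S y.
Proof. by elim: n => //= n ->; rewrite linearD. Qed.

Lemma iter_linear0 n : iter n S 0 = 0.
Proof. by elim: n => //= n ->; rewrite linear0. Qed.

Lemma mixing_pair0 : mixing_pair S 0 0.
Proof.
move=> e e0; apply: sub_cofinite_set (cofinite_setT nat) => n _.
by exists 0; rewrite iter_linear0 subr0 rnorm0.
Qed.

(** Linearity allows witnesses to be added, and two cofinite sets of exponents meet in a cofinite
    one. *)
Lemma mixing_pairD (x y x' y' : Y) : mixing_pair S x y ->
  mixing_pair S x' y' -> mixing_pair S (x + x') (y + y').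
Proof.
move=> xy xy' e e0; have e20 : 0 < e / 2 by rewrite divr_gt0.
have := conj (xy _ e20) (xy' _ e20); rewrite -cofinite_setI.
apply: sub_cofinite_set.
move=> n [[z [xz yz]] [z' [xz' yz']]]; exists (z + z').
rewrite iter_linearD !opprD (addrACA z) (addrACA (iter n S z)) (splitr e).
by split; rewrite (le_lt_trans (ler_rnormD _ _))// ltrD.
Qed.

(** A witness at radius [e / 2] for a pair [e / 2]-close to [(x, y)] serves [(x, y)] at radius [e],
    with the same exponents. *)
Lemma mixing_pair_closed (x y : Y) :
  (forall e : R, 0 < e -> exists x' y',
    [/\ rnorm (x' - x) < e, rnorm (y' - y) < e & mixing_pair S x' y']) ->
  mixing_pair S x y.
Proof.
move=> xy e e0; have e20 : 0 < e / 2 by rewrite divr_gt0.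
have [x' [y' [xx' yy' xy']]] := xy _ e20.
apply: sub_cofinite_set (xy' _ e20) => n [z [xz yz]]; exists z.
split; rewrite (splitr e).
  by rewrite -[z](subrK x') -addrA (le_lt_trans (ler_rnormD _ _))// ltrD//.
rewrite -[iter n S z](subrK y') -addrA (le_lt_trans (ler_rnormD _ _))//.
by rewrite ltrD.
Qed.

End mixing_pairs.

(** * Families over the integers supported at one place *)

Section finite_support.
Context {V : nmodType}.

Definition int_delta (k : int) (a : V) : int -> V :=
  fun j => if j == k then a else 0.

Lemma sum_int_delta (t : seq int) (x : int -> V) j : uniq t ->
  \sum_(k <- t) int_delta k (x k) j = if j \in t then x j else 0.
Proof.
rewrite /int_delta => ut; have [jt|jt] := boolP (j \in t).
  rewrite (bigD1_seq j)//= eqxx big1 ?addr0// => i ij.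
  by rewrite eq_sym (negPf ij).
by rewrite big1_seq// => i /andP[_ it]; case: eqP => // ji; rewrite ji it in jt.
Qed.

End finite_support.

(** * The equivalence on an abstract sequence space *)

Section shift_mixing.
Context {R : realType} {s : scalars}.
(** [E] stands for either sequence space, so that one argument covers both. *)
Variables (X E : normedModType (scalar_field R s)).
Variables (T : {linear X -> X}) (B : {linear E -> E}).
Variables (coord : E -> int -> X) (delta : int -> X -> E).
Hypothesis coord0 : forall k, coord 0 k = 0.
Hypothesis coordB : forall x y k, coord (x - y) k = coord x k - coord y k.
Hypothesis coord_inj : injective coord.
Hypothesis rnorm_coord : forall x k, rnorm (coord x k) <= rnorm x.
Hypothesis coord_delta : forall k a, coord (delta k a) = int_delta k a.
Hypothesis rnorm_delta : forall k a, rnorm (delta k a) <= rnorm a.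
Hypothesis coord_shift : forall x, coord (B x) = shift_seq T (coord x).
(** Quantifying over [y] avoids constructing the truncation of [x] to [t] inside [E]; it is realized
    later as a finite sum of [delta]s. *)
Hypothesis finite_support_dense : forall (x : E) (e : R), 0 < e ->
  exists2 t : seq int, uniq t & forall y : E,
    (forall j, coord y j = if j \in t then coord x j else 0) ->
    rnorm (x - y) < e.

Lemma coordD x y k : coord (x + y) k = coord x k + coord y k.
Proof. by rewrite -[x in RHS](addrK y) coordB subrK. Qed.

Lemma coord_sum (t : seq int) (f : int -> E) j :
  coord (\sum_(k <- t) f k) j = \sum_(k <- t) coord (f k) j.
Proof.
apply: (big_morph (coord^~ j)); [by move=> x y; rewrite coordD|exact: coord0].
Qed.

Lemma coord_iter n x k : coord (iter n B x) k = iter n T (coord x (k + n%:Z)).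
Proof.
elim: n x k => [|n IH] x k; first by rewrite addr0.
by rewrite iterS coord_shift /shift_seq IH -iterS -addrA -PoszD add1n.
Qed.

Lemma deltaB k a b : delta k a - delta k b = delta k (a - b).
Proof.
apply/coord_inj/funext => j; rewrite coordB !coord_delta /int_delta.
by case: eqP => // _; rewrite subr0.
Qed.

Lemma delta0 k : delta k 0 = 0.
Proof.
by apply/coord_inj/funext => j; rewrite coord_delta coord0 /int_delta if_same.
Qed.

(** Coordinate [j] of the left side is [iter n T] applied to entry [j + n], which is [a] for
    [j = k - n] and zero elsewhere. *)
Lemma iter_delta n k a :
  iter n B (delta k a) = delta (k - n%:Z) (iter n T a).
Proof.
apply/coord_inj/funext => j; rewrite coord_iter !coord_delta /int_delta.
by rewrite -subr_eq opprK; case: eqP => // _; rewrite iter_linear0.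
Qed.

Lemma mixing_pair_delta_l k a : mixing_pair T a 0 ->
  mixing_pair B (delta k a) 0.
Proof.
move=> aT e e0; apply: sub_cofinite_set (aT e e0) => n [z [az Tz]].
(* The entry drifts to place [k - n], but the norm bound on [delta] is the same at every place. *)
exists (delta k z); rewrite deltaB iter_delta subr0; rewrite subr0 in Tz.
by split; exact: le_lt_trans (rnorm_delta _ _) _.
Qed.

Lemma mixing_pair_delta_r k a : mixing_pair T 0 a ->
  mixing_pair B 0 (delta k a).
Proof.
move=> aT e e0; apply: sub_cofinite_set (aT e e0) => n [z [az Tz]].
(* Starting [n] places further right makes the entry land at [k]. *)
exists (delta (k + n%:Z) z); rewrite iter_delta addrK deltaB subr0.
by rewrite subr0 in az; split; exact: le_lt_trans (rnorm_delta _ _) _.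
Qed.

Lemma mixing_pair_coord_l x k :
  mixing_pair B x 0 -> mixing_pair T (coord x k) 0.
Proof.
move=> xB e e0; apply: sub_cofinite_set (xB e e0) => n [z [xz Bz]].
exists (coord z k); rewrite -coordB (le_lt_trans (rnorm_coord _ _))//.
split=> //; rewrite subr0 in Bz; rewrite subr0 (le_lt_trans _ Bz)//.
(* The image under [T^n] of entry [k] of [z] is read off [B^n z] at place [k - n]. *)
by rewrite (le_trans _ (rnorm_coord _ (k - n%:Z)))// coord_iter subrK.
Qed.

Lemma mixing_pair_coord_r y k :
  mixing_pair B 0 y -> mixing_pair T 0 (coord y k).
Proof.
move=> yB e e0; apply: sub_cofinite_set (yB e e0) => n [z [xz Bz]].
exists (coord z (k + n%:Z)); rewrite subr0 in xz; rewrite subr0.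
rewrite (le_lt_trans (rnorm_coord _ _))//; split=> //.
by rewrite -coord_iter -coordB (le_lt_trans (rnorm_coord _ _)).
Qed.

Lemma delta_approx x (e : R) : 0 < e -> exists t : seq int,
  rnorm (\sum_(k <- t) delta k (coord x k) - x) < e.
Proof.
move=> e0; have [t ut xt] := finite_support_dense x e0; exists t.
rewrite -rnormN opprB; apply: xt => j; rewrite coord_sum.
under eq_bigr do rewrite coord_delta; exact: sum_int_delta.
Qed.

Lemma shift_mixing : mixing B <-> mixing T.
Proof.
split=> [/mixingP mB|/mixingP mT]; apply/mixingP => x y.
  have coord_delta0 a : coord (delta 0 a) 0 = a.
    by rewrite coord_delta /int_delta eqxx.
  (* Split [(x, y)] as [(x, 0) + (0, y)] and view each half at coordinate 0. *)
  rewrite -[x]addr0 -[y]add0r; apply: mixing_pairD.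
    by rewrite -(coord_delta0 x); exact/mixing_pair_coord_l.
  by rewrite -(coord_delta0 y); exact/mixing_pair_coord_r.
(* Finite sums of [delta]s approximate [x] and [y]; additivity reduces these to single [delta]s. *)
apply: mixing_pair_closed => e e0.
have [t xt] := delta_approx x e0; have [u yu] := delta_approx y e0.
exists (\sum_(k <- t) delta k (coord x k)), (\sum_(k <- u) delta k (coord y k)).
split=> //; rewrite -[X in mixing_pair _ X _]addr0.
rewrite -[X in mixing_pair _ _ X]add0r; apply: mixing_pairD.
  apply: (big_ind (fun z => mixing_pair B z 0)) => [|z z' zP zP'|k _].
  - exact: mixing_pair0.
  - by rewrite -[0]addr0; exact: mixing_pairD.
  - exact: mixing_pair_delta_l.
apply: (big_ind (mixing_pair B 0)) => [|z z' zP zP'|k _].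
- exact: mixing_pair0.
- by rewrite -[0]addr0; exact: mixing_pairD.
- exact: mixing_pair_delta_r.
Qed.

End shift_mixing.

(** * Finitely supported sequences in the sup norm *)

Section c0_finite_support.
Context {R : realType} {s : scalars} {X : normedModType (scalar_field R s)}.

Lemma int_delta_c0 k (a : X) : int_delta k a \in @c0_mem R s X.
Proof.
(* The successor excludes [j = k], the only place where the entry may be nonzero. *)
apply/c0_memP => e e0; exists (absz k).+1 => j.
by rewrite /int_delta; case: eqP => [->|_ _]; rewrite ?ltnn ?rnorm0.
Qed.

Definition c0_delta k (a : X) : c0 X := C0 (int_delta_c0 k a).

Lemma rnorm_c0_delta k (a : X) : rnorm (c0_delta k a) <= rnorm a.
Proof.
rewrite rnorm_c0; apply/c0_norm_le => j /=; rewrite /int_delta.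
by case: eqP => // _; rewrite rnorm0 rnorm_ge0.
Qed.

Lemma c0_finite_support_dense (x : c0 X) (e : R) : 0 < e ->
  exists2 t : seq int, uniq t & forall y : c0 X,
    (forall j, y j = if j \in t then x j else 0) -> rnorm (x - y) < e.
Proof.
move=> e0; have e20 : 0 < e / 2 by rewrite divr_gt0.
have [N NP] := c0P x e20.
(* All integers of absolute value below [N]; 0 occurs in both halves, hence [undup]. *)
exists (undup ([seq Posz n | n <- iota 0 N] ++
               [seq - Posz n | n <- iota 0 N])); first exact: undup_uniq.
move=> y yP; rewrite (@le_lt_trans _ _ (e / 2)) ?ltr_pdivrMr ?ltr_pMr ?ltr1n//.
rewrite rnorm_c0; apply/c0_norm_le => j.
have -> : (x - y) j = x j - y j by [].
rewrite yP; case: ifPn => [_|]; first by rewrite subrr rnorm0 ltW.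
rewrite mem_undup mem_cat subr0 => jt; apply/ltW/NP.
rewrite leqNgt; apply: contra jt => jN; apply/orP.
case: j jN {yP} => n jN; [left|right].
  by apply/mapP; exists n => //; rewrite mem_iota.
by apply/mapP; exists n.+1; rewrite ?mem_iota ?NegzE.
Qed.

End c0_finite_support.

(** * Finitely supported sequences in the p-norm *)

Section lp_finite_support.
Context {R : realType} {s : scalars} {X : normedModType (scalar_field R s)}.
Variables (p : R) (p1 : 1 <= p).

Let p_gt0 : 0 < p. Proof. exact: lt_le_trans p1. Qed.

Lemma int_delta_sum (k : int) (a : X) (t : seq int) : uniq t ->
  \sum_(j <- t) rnorm (int_delta k a j) `^ p <= rnorm a `^ p.
Proof.
(* Exchanging the roles of [j] and [k] turns this into a sum of [int_delta]s evaluated at [k]. *)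
move=> ut; have -> : \sum_(j <- t) rnorm (int_delta k a j) `^ p =
    \sum_(j <- t) int_delta j (rnorm a `^ p) k.
  apply: eq_bigr => j _; rewrite /int_delta eq_sym; case: eqP => // _.
  by rewrite rnorm0 powR0// gt_eqF.
by rewrite (sum_int_delta (fun=> _))//; case: ifP => // _; exact: powR_ge0.
Qed.

Lemma int_delta_lp k (a : X) : int_delta k a \in @lp_mem R s X p.
Proof.
apply/(lp_memP p1); exists (rnorm a + 1); first by rewrite ltr_wpDl ?rnorm_ge0.
move=> t ut; rewrite (le_trans (int_delta_sum k a ut))//.
by rewrite ge0_ler_powR ?nnegrE ?addr_ge0 ?rnorm_ge0 ?lerDl// ltW.
Qed.

Definition lp_delta k (a : X) : lp X p1 := Lp p1 (int_delta_lp k a).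

Lemma rnorm_lp_delta k (a : X) : rnorm (lp_delta k a) <= rnorm a.
Proof.
rewrite rnorm_lp; apply: (iffRL (lp_norm_le _ (rnorm_ge0 _))) => t.
exact: int_delta_sum.
Qed.

(** Once the terms over [t] come within [(e / 2) ^ p] of the total sum [S], those over any finite
    set disjoint from [t] add up to at most [(e / 2) ^ p]. *)
Lemma lp_finite_support_dense (x : lp X p1) (e : R) : 0 < e ->
  exists2 t : seq int, uniq t & forall y : lp X p1,
    (forall j, y j = if j \in t then x j else 0) -> rnorm (x - y) < e.
Proof.
move=> e0; have e20 : 0 < e / 2 by rewrite divr_gt0.
have ep0 : 0 < (e / 2) `^ p by rewrite powR_gt0.
pose f k := rnorm (x k) `^ p; pose S := fine (lp_sum p x).
have f0 k : 0 <= f k by exact: powR_ge0.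
have SE : lp_sum p x = S%:E by rewrite fineK// lp_sum_fin.
have fS : forall t : seq int, uniq t -> \sum_(k <- t) f k <= S.
  by apply/esum_leP; rewrite -SE.
have [t ut tS] : exists2 t : seq int, uniq t &
    S - (e / 2) `^ p < \sum_(k <- t) f k.
  (* Otherwise [S - (e / 2) ^ p] would bound all finite sums, hence [S] itself. *)
  apply: contrapT => nt.
  have : (lp_sum p x <= (S - (e / 2) `^ p)%:E)%E.
    apply/esum_leP => t ut; rewrite leNgt; apply/negP => tS.
    by apply: nt; exists t.
  by rewrite SE lee_fin lerBrDr gerDl leNgt ep0.
exists t => // y yP.
rewrite (@le_lt_trans _ _ (e / 2)) ?ltr_pdivrMr ?ltr_pMr ?ltr1n//.
rewrite rnorm_lp; apply: (iffRL (lp_norm_le _ (ltW e20))) => u uu.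
have -> : \sum_(k <- u) rnorm ((x - y) k) `^ p =
    \sum_(k <- [seq k <- u | k \notin t]) f k.
  rewrite big_filter [RHS]big_mkcond; apply: eq_bigr => k _.
  have -> : (x - y) k = x k - y k by [].
  rewrite yP; case: ifPn => _ /=; last by rewrite subr0.
  by rewrite subrr rnorm0 powR0// gt_eqF.
(* Without repetitions, the joint list also has sum at most [S]. *)
have : uniq (t ++ [seq k <- u | k \notin t]).
  rewrite cat_uniq ut filter_uniq// andbT /=; apply/hasPn => k.
  by rewrite mem_filter => /andP[].
move=> /fS; rewrite big_cat/= => tuS.
by move: tS; rewrite ltrBlDr => /(le_lt_trans tuS); rewrite ltrD2l => /ltW.
Qed.

End lp_finite_support.

Theorem corollary3p2 (R : realType) (s : scalars)
    (X : completeNormedModType (scalar_field R s)) (T : {linear X -> X})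
    (T_cont : continuous T) :
  (mixing (B_c0 T_cont) <-> mixing T) /\
  (forall (p : R) (p1 : 1 <= p), mixing (B_lp T_cont p1) <-> mixing T).
Proof.
split=> [|p p1].
  (* The coordinate identities hold by computation; injectivity, the two norm bounds and density
     remain. *)
  apply: (@shift_mixing R s X (c0 X) T (B_c0 T_cont) (@c0_val R s X) c0_delta)
    => //.
  - exact: val_inj.
  - by move=> x k; rewrite rnorm_c0 rnorm_le_c0_norm.
  - exact: rnorm_c0_delta.
  - exact: c0_finite_support_dense.
apply: (@shift_mixing R s X (lp X p1) T (B_lp T_cont p1) (@lp_val R s X p p1)
  (lp_delta p1)) => //.
- exact: val_inj.
- by move=> x k; rewrite rnorm_lp rnorm_le_lp_norm.
- exact: rnorm_lp_delta.
- exact: lp_finite_support_dense.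
Qed.
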